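(* Let $B\times_fF$ be a degenerate warped product with almost product structure $J=(J_1,J_2)$, and let $X,Y,Z\in\Gamma(TB)$ and $U,V,W\in\Gamma(TF)$ (lifted to $B\times F$). Let $\widetilde{\mathcal K}$ be the almost product Koszul form on $B\times_fF$ and $\widetilde{\mathcal K}_B$, $\widetilde{\mathcal K}_F$ the lifts of the almost product Koszul forms of $(B,g_B,J_1)$ and $(F,g_F,J_2)$. Then: (1) $\widetilde{\mathcal K}(X,Y,Z)=\widetilde{\mathcal K}_B(X,Y,Z)$; (2) $\widetilde{\mathcal K}(X,Y,W)=\widetilde{\mathcal K}(X,W,Y)=\widetilde{\mathcal K}(W,X,Y)=0$; (3) $\widetilde{\mathcal K}(X,V,W)=f\,g_F(V,W)\,X(f)$; (4) $\widetilde{\mathcal K}(V,X,W)=-\widetilde{\mathcal K}(V,W,X)=\tfrac12\big[f\,g_F(V,W)X(f)+f\,(JX)(f)\,g_F(V,JW)\big]$; (5) $\widetilde{\mathcal K}(U,V,W)=f^2\,\widetilde{\mathcal K}_F(U,V,W)$.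
   Context: A singular semi-Riemannian manifold $(M,g)$ is a smooth manifold with a smooth symmetric $(0,2)$-tensor field $g=\langle\cdot,\cdot\rangle$, possibly degenerate and of varying signature. It is an almost product singular semi-Riemannian manifold if it carries $J:TM\to TM$ with $J^2=\mathrm{id}$ and $g(JX,JY)=g(X,Y)$ for all $X,Y$. The Koszul form is $\mathcal K(X,Y,Z)=\tfrac12\{X\langle Y,Z\rangle+Y\langle Z,X\rangle-Z\langle X,Y\rangle-\langle X,[Y,Z]\rangle+\langle Y,[Z,X]\rangle+\langle Z,[X,Y]\rangle\}$, and the almost product Koszul form is $\widetilde{\mathcal K}(X,Y,Z)=\tfrac12[\mathcal K(X,Y,Z)+\mathcal K(X,JY,JZ)]$. Let $(B,g_B,J_1)$ and $(F,g_F,J_2)$ be almost product singular semi-Riemannian manifolds and $f\in C^\infty(B)$ (possibly with zeros). The (degenerate) warped product $B\times_fF$ is $B\times F$ with the metric $\pi_B^*(g_B)+(f\circ\pi_B)^2\pi_F^*(g_F)$ and the almost product structure $J=(J_1,J_2)$, acting as $J_1$ on $TB$ and as $J_2$ on $TF$. Objects on $B$, $F$ are identified with their lifts. *)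

(* Defs.v *)
From mathcomp Require Import all_boot all_order all_algebra.
From mathcomp Require Import all_classical all_reals all_analysis.

Set Implicit Arguments.
Unset Strict Implicit.
Unset Printing Implicit Defensive.

Import Order.TTheory GRing.Theory Num.Theory.
Import numFieldNormedType.Exports.

Local Open Scope classical_set_scope.
Local Open Scope ring_scope.

(* f is of class C^k on U (U is always open below): all iterated directional
   derivatives of order <= k exist and are continuous on U. *)
Fixpoint Ck_on (R : realType) (n k : nat) (U : set 'rV[R]_n)
    (f : 'rV[R]_n -> R) : Prop :=
  (forall x, U x -> {for x, continuous f}) /\
  if k is k'.+1 then
    forall v, (forall x, U x -> derivable f x v) /\ Ck_on k' U ('D_v f)
  else True.

Definition smooth_on (R : realType) (n : nat) (U : set 'rV[R]_n)
    (f : 'rV[R]_n -> R) : Prop :=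
  forall k, Ck_on k U f.

(* A homeomorphism from the open set chart_dom of T onto the open set chart_cod
   of R^n; chart_map and chart_inv are junk outside these sets. *)
Record chart (R : realType) (T : topologicalType) (n : nat) := Chart {
  chart_dom : set T;
  chart_cod : set 'rV[R]_n;
  chart_map : T -> 'rV[R]_n;
  chart_inv : 'rV[R]_n -> T;
  chart_dom_open : open chart_dom;
  chart_cod_open : open chart_cod;
  chart_map_cod : forall p, chart_dom p -> chart_cod (chart_map p);
  chart_inv_dom : forall x, chart_cod x -> chart_dom (chart_inv x);
  chart_mapK : forall p, chart_dom p -> chart_inv (chart_map p) = p;
  chart_invK : forall x, chart_cod x -> chart_map (chart_inv x) = x;
  chart_map_continuous :
    forall p, chart_dom p -> {for p, continuous chart_map};
  chart_inv_continuous :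
    forall x, chart_cod x -> {for x, continuous chart_inv}
}.

(* Every coordinate of the transition map d o c^-1 is smooth on
   c(dom c `&` dom d). *)
Definition smooth_transition (R : realType) (T : topologicalType) (n : nat)
    (c d : chart R T n) : Prop :=
  forall i, smooth_on (chart_cod c `&` chart_inv c @^-1` chart_dom d)
                      (fun x => chart_map d (chart_inv c x) ord0 i).

(* The atlas is not required to be maximal. *)
Record smooth_manifold (R : realType) := SmoothManifold {
  mfd_sort :> topologicalType;
  mfd_dim : nat;
  mfd_atlas : set (chart R mfd_sort mfd_dim);
  mfd_hausdorff : hausdorff_space mfd_sort;
  mfd_second_countable : @second_countable mfd_sort;
  mfd_cover : forall p, exists2 c, mfd_atlas c & chart_dom c p;
  mfd_compatible :
    forall c d, mfd_atlas c -> mfd_atlas d -> smooth_transition c d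
}.

Definition smooth (R : realType) (M : smooth_manifold R) (h : M -> R) : Prop :=
  forall c, mfd_atlas c -> smooth_on (chart_cod c) (h \o chart_inv c).

(* Tangent vectors at p are the derivations at p of the algebra of smooth
   functions on M. They are represented by functionals on all real functions
   that vanish on nonsmooth functions, so that two tangent vectors are equal as
   soon as they agree on smooth functions. *)
Definition functional (R : realType) (M : smooth_manifold R) := (M -> R) -> R.

Definition tangent (R : realType) (M : smooth_manifold R) (p : M)
    (v : functional M) : Prop :=
  [/\ forall h, ~ smooth h -> v h = 0,
      forall (a : R) h k, smooth h -> smooth k ->
        v (fun x => a * h x + k x) = a * v h + v k
    & forall h k, smooth h -> smooth k ->
        v (fun x => h x * k x) = h p * v k + k p * v h].

Definition section (R : realType) (M : smooth_manifold R) := M -> functional M.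

Definition along (R : realType) (M : smooth_manifold R) (X : section M)
    (h : M -> R) : M -> R :=
  fun p => X p h.

Record vector_field (R : realType) (M : smooth_manifold R) := VectorField {
  vf_section :> section M;
  vf_tangent : forall p, tangent p (vf_section p);
  vf_smooth : forall h, smooth h -> smooth (along vf_section h)
}.

Definition bracket (R : realType) (M : smooth_manifold R) (X Y : section M) :
    section M :=
  fun p h => X p (along Y h) - Y p (along X h).

(* Tensors are families indexed by the points of M; only their values on tangent
   vectors matter. *)
Definition bilinear_field (R : realType) (M : smooth_manifold R) :=
  forall p : M, functional M -> functional M -> R.

Definition endo_field (R : realType) (M : smooth_manifold R) :=
  forall p : M, functional M -> functional M.

Definition inner (R : realType) (M : smooth_manifold R) (g : bilinear_field M)
    (X Y : section M) : M -> R :=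
  fun p => g p (X p) (Y p).

Definition act (R : realType) (M : smooth_manifold R) (J : endo_field M)
    (X : section M) : section M :=
  fun p => J p (X p).

(* Neither nondegeneracy nor constancy of the signature is required. *)
Record singular_metric (R : realType) (M : smooth_manifold R)
    (g : bilinear_field M) : Prop := SingularMetric {
  metric_linear : forall p (a : R) u v w,
    tangent p u -> tangent p v -> tangent p w ->
    g p (fun h => a * u h + v h) w = a * g p u w + g p v w;
  metric_symmetric : forall p v w, tangent p v -> tangent p w ->
    g p v w = g p w v;
  metric_smooth : forall X Y : vector_field M, smooth (inner g X Y)
}.

Record almost_product_structure (R : realType) (M : smooth_manifold R)
    (g : bilinear_field M) (J : endo_field M) : Prop := AlmostProductStructure {
  aps_tangent : forall p v, tangent p v -> tangent p (J p v);
  aps_linear : forall p (a : R) u v, tangent p u -> tangent p v ->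
    J p (fun h => a * u h + v h) = (fun h => a * J p u h + J p v h);
  aps_smooth : forall (X : vector_field M) h,
    smooth h -> smooth (along (act J X) h);
  aps_involutive : forall p v, tangent p v -> J p (J p v) = v;
  aps_isometry : forall p v w, tangent p v -> tangent p w ->
    g p (J p v) (J p w) = g p v w
}.

Record ap_manifold (R : realType) := APManifold {
  ap_mfd :> smooth_manifold R;
  ap_metric : bilinear_field ap_mfd;
  ap_struct : endo_field ap_mfd;
  ap_metricP : singular_metric ap_metric;
  ap_structP : almost_product_structure ap_metric ap_struct
}.

Arguments ap_metric {R} _ _ _ _ : rename.
Arguments ap_struct {R} _ _ _ _ : rename.

Definition koszul (R : realType) (M : smooth_manifold R) (g : bilinear_field M)
    (X Y Z : section M) : M -> R :=
  fun p => 2^-1 *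
    (X p (inner g Y Z) + Y p (inner g Z X) - Z p (inner g X Y)
     - inner g X (bracket Y Z) p + inner g Y (bracket Z X) p
     + inner g Z (bracket X Y) p).

Definition ap_koszul (R : realType) (M : smooth_manifold R)
    (g : bilinear_field M) (J : endo_field M) (X Y Z : section M) : M -> R :=
  fun p => 2^-1 * (koszul g X Y Z p + koszul g X (act J Y) (act J Z) p).

Section Ck_affine.
Variables (R : realType) (m n : nat).

Lemma Ck_on_comp (A L : 'rV[R]_m -> 'rV[R]_n) (k : nat) (U : set 'rV[R]_n)
    (V : set 'rV[R]_m) (f : 'rV[R]_n -> R) :
  continuous A -> (forall h x v, A (h *: v + x) = h *: L v + A x) ->
  (forall x, V x -> U (A x)) -> Ck_on k U f -> Ck_on k V (f \o A).
Proof.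
move=> cA AL VU.
have quot g x v : (fun h : R =>
    h^-1 *: (((g \o A) \o shift x) (h *: v) - (g \o A) x)) =
    (fun h : R => h^-1 *: ((g \o shift (A x)) (h *: L v) - g (A x))).
  by apply/funext => h /=; rewrite AL.
have DA g v : 'D_v (g \o A) = 'D_(L v) g \o A.
  by apply/funext => x; rewrite /= /derive quot.
elim: k f => [|k IH] f [cf Df]; split=> //.
- by move=> x Vx; apply: (@continuous_comp _ _ _ A f); [exact: cA|exact/cf/VU].
- by move=> x Vx; apply: (@continuous_comp _ _ _ A f); [exact: cA|exact/cf/VU].
move=> v; split=> [x Vx|]; last by rewrite DA; apply: IH; exact: (Df _).2.
by rewrite /derivable quot; exact: ((Df (L v)).1 _ (VU _ Vx)).
Qed.

End Ck_affine.

Section prod_manifold.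
Variable R : realType.

Lemma continuous_rV (T : topologicalType) n (f : T -> 'rV[R]_n) (x : T) :
  (forall j, {for x, continuous (fun y => f y ord0 j)}) ->
  {for x, continuous f}.
Proof.
move=> cf; apply/cvg_ballP => e e0.
have : \forall y \near x, forall j, ball (f x ord0 j) e (f y ord0 j).
  by apply: filter_forall => j; have /cvg_ballP/(_ _ e0) := cf j.
by apply: filterS => y fxy; split=> // i j; rewrite ord1.
Qed.

Lemma row_mx_continuous (T : topologicalType) m n (f : T -> 'rV[R]_m)
    (g : T -> 'rV[R]_n) (x : T) :
  {for x, continuous f} -> {for x, continuous g} ->
  {for x, continuous (fun y => row_mx (f y) (g y))}.
Proof.
move=> cf cg; apply: continuous_rV => j; case: (split_ordP j) => i ->.
- rewrite (_ : (fun _ => _) = (fun M : 'rV_m => M ord0 i) \o f); last first.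
    by apply/funext => y /=; rewrite row_mxEl.
  apply: (@continuous_comp _ _ _ f (fun M : 'rV_m => M ord0 i)) => //.
  exact: coord_continuous.
- rewrite (_ : (fun _ => _) = (fun M : 'rV_n => M ord0 i) \o g); last first.
    by apply/funext => y /=; rewrite row_mxEr.
  apply: (@continuous_comp _ _ _ g (fun M : 'rV_n => M ord0 i)) => //.
  exact: coord_continuous.
Qed.

Lemma lsubmx_continuous m n : continuous (@lsubmx R 1 m n).
Proof.
move=> x; apply: continuous_rV => j.
rewrite (_ : (fun _ => _) = fun M : 'rV_(m + n) => M ord0 (lshift n j)).
  exact: coord_continuous.
by apply/funext => y; rewrite mxE.
Qed.

Lemma rsubmx_continuous m n : continuous (@rsubmx R 1 m n).
Proof.
move=> x; apply: continuous_rV => j.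
rewrite (_ : (fun _ => _) = fun M : 'rV_(m + n) => M ord0 (rshift m j)).
  exact: coord_continuous.
by apply/funext => y; rewrite mxE.
Qed.


Lemma lsubmxPlin m n (h : R) (x v : 'rV[R]_(m + n)) :
  lsubmx (h *: v + x) = h *: lsubmx v + lsubmx x.
Proof. by rewrite linearP. Qed.

Lemma rsubmxPlin m n (h : R) (x v : 'rV[R]_(m + n)) :
  rsubmx (h *: v + x) = h *: rsubmx v + rsubmx x.
Proof. by rewrite linearP. Qed.

Lemma prod_hausdorff (S T : topologicalType) :
  hausdorff_space S -> hausdorff_space T -> hausdorff_space (S * T)%type.
Proof.
move=> hS hT [s t] [s' t'] cl; congr pair.
- apply: hS => A B sA s'B.
  have [||[u w] [/= [Au _] [Bu _]]] := cl (A `*` setT) (B `*` setT).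
  + by exists (A, setT) => //; split=> //; exact: filterT.
  + by exists (B, setT) => //; split=> //; exact: filterT.
  by exists u.
- apply: hT => A B tA t'B.
  have [||[u w] [/= [_ Aw] [_ Bw]]] := cl (setT `*` A) (setT `*` B).
  + by exists (setT, A) => //; split=> //; exact: filterT.
  + by exists (setT, B) => //; split=> //; exact: filterT.
  by exists w.
Qed.

Lemma prod_open (S T : topologicalType) (A : set S) (B : set T) :
  open A -> open B -> open (A `*` B).
Proof.
rewrite !openE => oA oB [s t] [/= As Bt].
by exists (A, B) => //; split; [exact: oA|exact: oB].
Qed.

Lemma prod_second_countable (S T : topologicalType) :
  @second_countable S -> @second_countable T ->
  @second_countable (S * T)%type.
Proof.
move=> [BS cS [oS bS]] [BT cT [oT bT]].
exists ((fun AB : set S * set T => AB.1 `*` AB.2) @` (BS `*` BT)).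
  exact: card_le_trans (card_image_le _ _) (countableX cS cT).
split=> [_ [[A B] [/= SA TB] <-]|].
  by apply: prod_open; [exact: oS|exact: oT].
move=> [s t] P [[A B] [/= sA tB] ABP].
have [A' [SA' A's] A'A] := bS s A sA.
have [B' [TB' B't] B'B] := bT t B tB.
exists (A' `*` B'); first by split=> //; exists (A', B').
by move=> [x y] [/= A'x B'y]; apply: ABP; split; [exact: A'A|exact: B'B].
Qed.

Section prod_chart.
Variables (S T : topologicalType) (m n : nat).
Variables (c : chart R S m) (d : chart R T n).

Let pdom := chart_dom c `*` chart_dom d.
Let pcod :=
  [set x : 'rV[R]_(m + n) | chart_cod c (lsubmx x) /\ chart_cod d (rsubmx x)].
Let pmap (p : S * T) := row_mx (chart_map c p.1) (chart_map d p.2).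
Let pinv (x : 'rV[R]_(m + n)) :=
  (chart_inv c (lsubmx x), chart_inv d (rsubmx x)).

Let pdom_open : open pdom.
Proof. by apply: prod_open; exact: chart_dom_open. Qed.

Let pcod_open : open pcod.
Proof.
apply: openI; apply: open_comp; try exact: chart_cod_open.
- by move=> x _; exact: lsubmx_continuous.
- by move=> x _; exact: rsubmx_continuous.
Qed.

Let pmap_cod p : pdom p -> pcod (pmap p).
Proof.
by move=> [p1 p2]; rewrite /pcod/= row_mxKl row_mxKr; split;
  exact: chart_map_cod.
Qed.

Let pinv_dom x : pcod x -> pdom (pinv x).
Proof. by move=> [x1 x2]; split; exact: chart_inv_dom. Qed.

Let pmapK p : pdom p -> pinv (pmap p) = p.
Proof.
by case: p => p q [/= ? ?]; rewrite /pinv row_mxKl row_mxKr !chart_mapK.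
Qed.

Let pinvK x : pcod x -> pmap (pinv x) = x.
Proof. by move=> [? ?]; rewrite /pmap/= !chart_invK// hsubmxK. Qed.

Let pmap_continuous p : pdom p -> {for p, continuous pmap}.
Proof.
move=> [p1 p2]; apply: row_mx_continuous.
- apply: (@continuous_comp _ _ _ fst (chart_map c)); first exact: cvg_fst.
  exact: chart_map_continuous.
- apply: (@continuous_comp _ _ _ snd (chart_map d)); first exact: cvg_snd.
  exact: chart_map_continuous.
Qed.

Let pinv_continuous x : pcod x -> {for x, continuous pinv}.
Proof.
move=> [x1 x2].
have cl : {for x, continuous (chart_inv c \o @lsubmx R 1 m n)}.
  apply: continuous_comp; first exact: lsubmx_continuous.
  exact: chart_inv_continuous.
have cr : {for x, continuous (chart_inv d \o @rsubmx R 1 m n)}.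
  apply: continuous_comp; first exact: rsubmx_continuous.
  exact: chart_inv_continuous.
exact: (cvg_pair cl cr).
Qed.

Definition prod_chart : chart R (S * T)%type (m + n) :=
  Chart pdom_open pcod_open pmap_cod pinv_dom pmapK pinvK
    pmap_continuous pinv_continuous.

End prod_chart.

Lemma prod_smooth_transition (S T : topologicalType) m n
    (c c' : chart R S m) (d d' : chart R T n) :
  smooth_transition c c' -> smooth_transition d d' ->
  smooth_transition (prod_chart c d) (prod_chart c' d').
Proof.
move=> cc' dd' i k; case: (split_ordP i) => j -> /=.
- rewrite (_ : (fun _ => _) =
    (fun x => chart_map c' (chart_inv c x) ord0 j) \o lsubmx); last first.
    by apply/funext => x /=; rewrite row_mxEl.
  apply: (Ck_on_comp (L := lsubmx) (@lsubmx_continuous m n) _ _ (cc' j k)).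
    exact: lsubmxPlin.
  by move=> x /= [[? ?] [? ?]].
- rewrite (_ : (fun _ => _) =
    (fun x => chart_map d' (chart_inv d x) ord0 j) \o rsubmx); last first.
    by apply/funext => x /=; rewrite row_mxEr.
  apply: (Ck_on_comp (L := rsubmx) (@rsubmx_continuous m n) _ _ (dd' j k)).
    exact: rsubmxPlin.
  by move=> x /= [[? ?] [? ?]].
Qed.

Variables B F : smooth_manifold R.

Let prod_atlas : set (chart R (B * F)%type (mfd_dim B + mfd_dim F)) :=
  [set e | exists2 cd : chart R B (mfd_dim B) * chart R F (mfd_dim F),
    mfd_atlas cd.1 /\ mfd_atlas cd.2 & e = prod_chart cd.1 cd.2].

Let prod_cover p : exists2 c, prod_atlas c & chart_dom c p.
Proof.
have [c Bc cp] := mfd_cover p.1; have [d Fd dp] := mfd_cover p.2.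
by exists (prod_chart c d) => //; exists (c, d).
Qed.

Let prod_compatible c d :
  prod_atlas c -> prod_atlas d -> smooth_transition c d.
Proof.
move=> [[c1 c2] [/= ? ?] ->] [[d1 d2] [/= ? ?] ->].
by apply: prod_smooth_transition; exact: mfd_compatible.
Qed.

Definition prod_manifold : smooth_manifold R :=
  SmoothManifold (prod_hausdorff (@mfd_hausdorff _ B) (@mfd_hausdorff _ F))
    (prod_second_countable (@mfd_second_countable _ B)
                           (@mfd_second_countable _ F))
    prod_cover prod_compatible.

End prod_manifold.

Definition differential (R : realType) (M N : smooth_manifold R) (phi : M -> N)
    (v : functional M) : functional N :=
  fun h => v (h \o phi).

Definition proj_base (R : realType) (B F : smooth_manifold R) :
  prod_manifold B F -> B := fst.

Definition proj_fiber (R : realType) (B F : smooth_manifold R) :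
  prod_manifold B F -> F := snd.

(* The inclusions of T_p B and T_q F into T_(p,q) (B x F), i.e., the
   differentials of b |-> (b, q) and of b |-> (p, b). The test for smoothness is
   there because a nonsmooth function may have smooth slices. *)
Definition incl_base (R : realType) (B F : smooth_manifold R) (q : F)
    (v : functional B) : functional (prod_manifold B F) :=
  fun h => if `[< smooth h >] then v (fun b => h (b, q)) else 0.

Definition incl_fiber (R : realType) (B F : smooth_manifold R) (p : B)
    (v : functional F) : functional (prod_manifold B F) :=
  fun h => if `[< smooth h >] then v (fun b => h (p, b)) else 0.

Definition lift_base (R : realType) (B F : smooth_manifold R) (X : section B) :
    section (prod_manifold B F) :=
  fun r => incl_base r.2 (X r.1).

Definition lift_fiber (R : realType) (B F : smooth_manifold R) (V : section F) :
    section (prod_manifold B F) :=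
  fun r => incl_fiber r.1 (V r.2).

Arguments lift_base {R B} F X _ _ : rename.
Arguments lift_fiber {R} B {F} V _ _ : rename.

Definition warped_metric (R : realType) (B F : smooth_manifold R)
    (gB : bilinear_field B) (gF : bilinear_field F) (f : B -> R) :
    bilinear_field (prod_manifold B F) :=
  fun r v w =>
    gB r.1 (differential (@proj_base _ B F) v)
           (differential (@proj_base _ B F) w)
    + f r.1 ^+ 2 * gF r.2 (differential (@proj_fiber _ B F) v)
                          (differential (@proj_fiber _ B F) w).

(* J = (J1, J2) with respect to T(B x F) = TB + TF. *)
Definition prod_struct (R : realType) (B F : smooth_manifold R)
    (J1 : endo_field B) (J2 : endo_field F) : endo_field (prod_manifold B F) :=
  fun r v h =>
    incl_base r.2 (J1 r.1 (differential (@proj_base _ B F) v)) h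
    + incl_fiber r.1 (J2 r.2 (differential (@proj_fiber _ B F) v)) h.

Definition warped_koszul (R : realType) (B F : ap_manifold R) (f : B -> R) :
    section (prod_manifold B F) -> section (prod_manifold B F) ->
    section (prod_manifold B F) -> B * F -> R :=
  ap_koszul (warped_metric (ap_metric B) (ap_metric F) f)
            (prod_struct (ap_struct B) (ap_struct F)).

(* Main.v *)
(* The warped metric only sees the projections of its arguments to TB and TF.
   The lift of X in TB sends h o pi_B to (X h) o pi_B and h o pi_F to 0 (and
   symmetrically for TF), so brackets of lifts project to lifts of brackets and
   mixed brackets project to 0. Hence the Koszul form of lifts reduces to that
   of a factor, except for the terms in which a vector field of B differentiates
   (f o pi_B)^2 g_F(V, W), which give 2 f X(f) g_F(V, W). Since J maps lifts to
   lifts, the almost product Koszul form follows by substitution. *)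
Require Import Defs.
From mathcomp Require Import all_boot all_order all_algebra.
From mathcomp Require Import all_classical all_reals all_analysis.
From mathcomp Require Import ring.

Set Implicit Arguments.
Unset Strict Implicit.
Unset Printing Implicit Defensive.

Import GRing.Theory.
Import numFieldNormedType.Exports.

Local Open Scope classical_set_scope.
Local Open Scope ring_scope.

(** * Locality and algebra of functions of class [C^k] on an open set *)

Section Ck_on_algebra.
Variables (R : realType) (n : nat) (U : set 'rV[R]_n).
Implicit Types f g : 'rV[R]_n -> R.

(** Continuity and directional derivatives are local, and [U] is a neighbourhood of each of its
    points. This serves the sum and product rules below, which identify ['D_v] of the combined
    function only at points of [U]. *)
Lemma Ck_on_eq k f g :
  open U -> (forall x, U x -> f x = g x) -> Ck_on k U f -> Ck_on k U g.
Proof.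
move=> oU.
have nearU (h h' : 'rV[R]_n -> R) x : (forall y, U y -> h y = h' y) -> U x ->
    \forall y \near x, h y = h' y.
  by move=> hh' Ux; apply: filterS (open_nbhs_nbhs (conj oU Ux)).
have ctsU (h h' : 'rV[R]_n -> R) : (forall y, U y -> h y = h' y) ->
    (forall x, U x -> {for x, continuous h}) ->
    forall x, U x -> {for x, continuous h'}.
  move=> hh' ch x Ux; have := ch _ Ux.
  rewrite /prop_for /continuous_at (hh' _ Ux); apply: cvg_trans.
  exact: (near_eq_cvg (F := nbhs x)) (nearU _ _ _ hh' Ux).
elim: k f g => [|k IH] f g fg [cf Df]; split=> //; try exact: ctsU fg cf.
move=> v; have [df Dfk] := Df v; split=> [x Ux|].
  exact: near_eq_derivable (nearU _ _ _ fg Ux) (df x Ux).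
apply: IH Dfk => x Ux; apply: near_eq_derive; exact: nearU.
Qed.

Lemma Ck_onW k f : Ck_on k.+1 U f -> Ck_on k U f.
Proof.
elim: k f => [|k IH] f [cf Df]; split=> // v.
by have [df Dfk] := Df v; split=> //; exact: IH.
Qed.

Lemma Ck_on_cst k (a : R) : Ck_on k U (fun=> a).
Proof.
elim: k a => [|k IH] a; split=> //; try by move=> x _; exact: cst_continuous.
move=> v; split=> [x _|]; first exact: derivable_cst.
rewrite (_ : 'D_v _ = fun=> 0)//.
by apply/funext => x; exact: derive_cst.
Qed.

Lemma Ck_onD k f g : open U -> Ck_on k U f -> Ck_on k U g ->
  Ck_on k U (fun x => f x + g x).
Proof.
move=> oU; elim: k f g => [|k IH] f g [cf Df] [cg Dg]; split=> //;
  try by move=> x Ux; exact: continuousD (cf _ Ux) (cg _ Ux).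
move=> v; have [df Dfk] := Df v; have [dg Dgk] := Dg v; split=> [x Ux|].
  exact: derivableD (df _ Ux) (dg _ Ux).
apply: Ck_on_eq (IH _ _ Dfk Dgk) => // x Ux.
by rewrite -(deriveD (df _ Ux) (dg _ Ux)).
Qed.

Lemma Ck_onM k f g : open U -> Ck_on k U f -> Ck_on k U g ->
  Ck_on k U (fun x => f x * g x).
Proof.
move=> oU; elim: k f g => [|k IH] f g Cf Cg; have [cf Df] := Cf;
  have [cg Dg] := Cg; split=> //;
  try by move=> x Ux; exact: continuousM (cf _ Ux) (cg _ Ux).
move=> v; have [df Dfk] := Df v; have [dg Dgk] := Dg v; split=> [x Ux|].
  exact: derivableM (df _ Ux) (dg _ Ux).
(* By Leibniz the derivative is [f * 'D_v g + g * 'D_v f]. The undifferentiated factors are of class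
   [k.+1] and are weakened to class [k] for the induction hypothesis. *)
apply: Ck_on_eq (Ck_onD oU (IH _ _ (Ck_onW Cf) Dgk) (IH _ _ (Ck_onW Cg) Dfk)).
  by [].
by move=> x Ux; rewrite -[LHS](deriveM (df _ Ux) (dg _ Ux)).
Qed.

End Ck_on_algebra.

(** * Constants and products of smooth functions *)

Section smooth_algebra.
Variables (R : realType) (M : smooth_manifold R).
Implicit Types h k : M -> R.

Lemma smooth_cst (a : R) : smooth (fun _ : M => a).
Proof. by move=> c _ k; exact: Ck_on_cst. Qed.

Lemma smoothM h k : smooth h -> smooth k -> smooth (fun x => h x * k x).
Proof.
by move=> sh sk c Mc m; apply: Ck_onM (sh c Mc m) (sk c Mc m);
  exact: chart_cod_open.
Qed.

End smooth_algebra.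

(** * Smoothness of pullbacks along the projections and of slices *)

Section smooth_prod.
Variables (R : realType) (B F : smooth_manifold R).
Local Notation P := (prod_manifold B F).

(** In a product chart, [h] composed with the projection is the coordinate expression of [h]
    composed with the linear map [lsubmx]. *)
Lemma smooth_comp_base (h : B -> R) :
  smooth h -> smooth (h \o @proj_base _ B F).
Proof.
move=> sh _ [[c d] [/= Bc Fd] ->] k.
apply: (Ck_on_comp (L := lsubmx) (@lsubmx_continuous R _ _) _ _ (sh c Bc k)).
  exact: lsubmxPlin.
by move=> x [].
Qed.

Lemma smooth_comp_fiber (h : F -> R) :
  smooth h -> smooth (h \o @proj_fiber _ B F).
Proof.
move=> sh _ [[c d] [/= Bc Fd] ->] k.
apply: (Ck_on_comp (L := rsubmx) (@rsubmx_continuous R _ _) _ _ (sh d Fd k)).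
  exact: rsubmxPlin.
by move=> x [].
Qed.

(** With a chart [d] around [q], the slice in coordinates is [h] read in a product chart,
    precomposed with the affine map [A] that appends the fixed coordinates of [q]; its linear part
    appends zeros. *)
Lemma smooth_slice_base (h : P -> R) (q : F) :
  smooth h -> smooth (fun b : B => h (b, q)).
Proof.
move=> sh c Bc k; have [d Fd dq] := mfd_cover q.
pose A (x : 'rV[R]_(mfd_dim B)) := row_mx x (chart_map d q).
have {sh}/(_ k) sh : smooth_on _ _ := sh (prod_chart c d)
  (ex_intro2 _ _ (c, d) (conj Bc Fd) erefl).
have -> : (fun b => h (b, q)) \o chart_inv c =
    (h \o chart_inv (prod_chart c d)) \o A.
  by apply/funext => x /=; rewrite /A row_mxKl row_mxKr chart_mapK.
apply: (Ck_on_comp (L := fun v => row_mx v 0) _ _ _ sh).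
- move=> x; apply: (@row_mx_continuous R _ _ _ id (cst _));
    [exact: cvg_id|exact: cst_continuous].
- by move=> a x v; rewrite /A scale_row_mx add_row_mx scaler0 add0r.
- move=> x cx; rewrite /A /= row_mxKl row_mxKr; split=> //.
  exact: chart_map_cod.
Qed.

Lemma smooth_slice_fiber (h : P -> R) (p : B) :
  smooth h -> smooth (fun b : F => h (p, b)).
Proof.
move=> sh d Fd k; have [c Bc cp] := mfd_cover p.
pose A (x : 'rV[R]_(mfd_dim F)) := row_mx (chart_map c p) x.
have {sh}/(_ k) sh : smooth_on _ _ := sh (prod_chart c d)
  (ex_intro2 _ _ (c, d) (conj Bc Fd) erefl).
have -> : (fun b => h (p, b)) \o chart_inv d =
    (h \o chart_inv (prod_chart c d)) \o A.
  by apply/funext => x /=; rewrite /A row_mxKl row_mxKr chart_mapK.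
apply: (Ck_on_comp (L := fun v => row_mx 0 v) _ _ _ sh).
- move=> x; apply: (@row_mx_continuous R _ _ _ (cst _) id);
    [exact: cst_continuous|exact: cvg_id].
- by move=> a x v; rewrite /A scale_row_mx add_row_mx scaler0 add0r.
- move=> x cx; rewrite /A /= row_mxKl row_mxKr; split=> //.
  exact: chart_map_cod.
Qed.

End smooth_prod.

(** * Derivations at a point, the bracket, and zero vectors in tensors *)

Section tangent_theory.
Variables (R : realType) (M : smooth_manifold R).
Implicit Types (p : M) (v w : functional M) (h k : M -> R).

Lemma tangent0 p : tangent p (fun=> 0).
Proof. by split=> // *; rewrite !mulr0 addr0. Qed.

Lemma tangent_fun0 p v : tangent p v -> v (fun=> 0) = 0.
Proof.
move=> [_ vD _]; have := vD 1 _ _ (@smooth_cst _ M 0) (@smooth_cst _ M 0).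
under eq_fun do rewrite mulr0 addr0.
(* An equation [x = x + x] is read as [x - x = x], which gives [x = 0]; the same manipulation recurs
   below. *)
by rewrite mul1r => /eqP; rewrite -subr_eq subrr eq_sym => /eqP.
Qed.

Lemma tangentD p v h k : tangent p v -> smooth h -> smooth k ->
  v (fun x => h x + k x) = v h + v k.
Proof.
move=> [_ vD _] sh sk; rewrite -[v h]mul1r -vD//.
by under [in RHS]eq_fun do rewrite mul1r.
Qed.

Lemma tangentZ p v a h : tangent p v -> smooth h ->
  v (fun x => a * h x) = a * v h.
Proof.
move=> tv sh; have [_ vD _] := tv.
rewrite -[RHS]addr0 -(tangent_fun0 tv) -vD//; last exact: smooth_cst.
by under [in RHS]eq_fun do rewrite addr0.
Qed.

Lemma tangentM p v h k : tangent p v -> smooth h -> smooth k ->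
  v (fun x => h x * k x) = h p * v k + k p * v h.
Proof. by move=> [_ _ vM] *; rewrite vM. Qed.

Lemma tangent_cst p v a : tangent p v -> v (fun=> a) = 0.
Proof.
move=> tv; have s1 := @smooth_cst _ M 1.
(* Leibniz applied to [1 * 1] gives [v 1 = v 1 + v 1]. *)
have v1 : v (fun=> 1) = 0.
  have := tangentM tv s1 s1; under eq_fun do rewrite mulr1.
  by rewrite !mul1r => /eqP; rewrite -subr_eq subrr eq_sym => /eqP.
have := tangentZ a tv s1; under eq_fun do rewrite mulr1.
by rewrite v1 mulr0.
Qed.

(** The metric laws hold on tangent vectors only, so brackets must be known to be tangent before
    they are paired with zero vectors. *)
Lemma tangent_bracket (X Y : vector_field M) p : tangent p (bracket X Y p).
Proof.
have [tX tY] := (vf_tangent X, vf_tangent Y).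
have [sX sY] := (@vf_smooth _ _ X, @vf_smooth _ _ Y).
have vanish (Z : vector_field M) h : ~ smooth h -> along Z h = fun=> 0.
  by move=> nh; apply/funext => x; have [+ _ _] := vf_tangent Z x; apply.
have linear (Z : vector_field M) x a h k : smooth h -> smooth k ->
    vf_section Z x (fun y => a * h y + k y) =
    a * vf_section Z x h + vf_section Z x k.
  by have [_ + _] := vf_tangent Z x; apply.
have alongD (Z : vector_field M) a h k : smooth h -> smooth k ->
    along Z (fun x => a * h x + k x) = fun x => a * along Z h x + along Z k x.
  by move=> sh sk; apply/funext => x; exact: linear.
have alongM (Z : vector_field M) h k : smooth h -> smooth k ->
    along Z (fun x => h x * k x) =
    fun x => h x * along Z k x + k x * along Z h x.
  by move=> sh sk; apply/funext => x; have [_ _] := vf_tangent Z x; apply.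
split=> [h nh|a h k sh sk|h k sh sk]; rewrite /bracket.
- by rewrite !vanish// !(tangent_fun0 (vf_tangent _ _)) subrr.
- rewrite !alongD// (linear X _ _ _ _ (sY _ sh) (sY _ sk)).
  by rewrite (linear Y _ _ _ _ (sX _ sh) (sX _ sk)); ring.
(* Both iterated derivatives of [h * k] are expanded by Leibniz twice; the mixed products of first
   derivatives are symmetric in [X] and [Y] and cancel. *)
- rewrite !alongM//.
  rewrite (tangentD (tX p) (smoothM sh (sY _ sk)) (smoothM sk (sY _ sh))).
  rewrite (tangentD (tY p) (smoothM sh (sX _ sk)) (smoothM sk (sX _ sh))).
  rewrite !(tangentM (tX p))//; try exact: sY.
  rewrite !(tangentM (tY p))//; try exact: sX.
  by rewrite /along; ring.
Qed.

Lemma metric0l (g : bilinear_field M) (gP : singular_metric g) p w :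
  tangent p w -> g p (fun=> 0) w = 0.
Proof.
move=> tw.
have := metric_linear gP 1 (tangent0 p) (tangent0 p) tw.
under eq_fun do rewrite mulr0 addr0.
by rewrite mul1r => /eqP; rewrite -subr_eq subrr eq_sym => /eqP.
Qed.

Lemma metric0r (g : bilinear_field M) (gP : singular_metric g) p w :
  tangent p w -> g p w (fun=> 0) = 0.
Proof.
by move=> tw; rewrite (metric_symmetric gP tw (tangent0 p)) metric0l.
Qed.

Lemma aps0 (g : bilinear_field M) (J : endo_field M) p :
  almost_product_structure g J -> J p (fun=> 0) = fun=> 0.
Proof.
move=> JP; have := aps_linear JP 1 (tangent0 p) (tangent0 p).
under eq_fun do rewrite mulr0 addr0.
move=> J0; apply/funext => h; have := congr1 (@^~ h) J0.
by rewrite /= mul1r => /eqP; rewrite -subr_eq subrr eq_sym => /eqP.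
Qed.

(** Bundling [J X] as a vector field lets the results on Koszul forms of lifts apply to it as
    well. *)
Definition act_vector_field (g : bilinear_field M) (J : endo_field M)
    (JP : almost_product_structure g J) (X : vector_field M) :=
  VectorField (fun p => aps_tangent JP (vf_tangent X p)) (aps_smooth JP X).

End tangent_theory.

(** * Lifts to the product: derivatives, projections, brackets and the action of J *)

Section lifts.
Variables (R : realType) (B F : smooth_manifold R).
Implicit Types (X Y : vector_field B) (V W : vector_field F).
Local Notation P := (prod_manifold B F).
Local Notation piB := (@proj_base _ B F).
Local Notation piF := (@proj_fiber _ B F).

Lemma lift_base_smooth X (r : P) h : smooth h ->
  lift_base F X r h = vf_section X r.1 (fun b => h (b, r.2)).
Proof. by move=> sh; rewrite /lift_base /incl_base asboolT. Qed.

Lemma lift_fiber_smooth V (r : P) h : smooth h ->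
  lift_fiber B V r h = vf_section V r.2 (fun b => h (r.1, b)).
Proof. by move=> sh; rewrite /lift_fiber /incl_fiber asboolT. Qed.

(* Valid for all h, smooth or not: a slice of h o piB is h itself, so both sides
   vanish when h is not smooth. *)
Lemma lift_base_comp_base X (r : P) h :
  lift_base F X r (h \o piB) = vf_section X r.1 h.
Proof.
have [sh|nh] := pselect (smooth h).
  by rewrite lift_base_smooth//; exact: smooth_comp_base.
rewrite /lift_base /incl_base asboolF; last first.
  by move=> /(@smooth_slice_base _ B F _ r.2).
by have [->] := vf_tangent X r.1.
Qed.

Lemma lift_fiber_comp_fiber V (r : P) h :
  lift_fiber B V r (h \o piF) = vf_section V r.2 h.
Proof.
have [sh|nh] := pselect (smooth h).
  by rewrite lift_fiber_smooth//; exact: smooth_comp_fiber.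
rewrite /lift_fiber /incl_fiber asboolF; last first.
  by move=> /(@smooth_slice_fiber _ B F _ r.1).
by have [->] := vf_tangent V r.2.
Qed.

(** At a fixed fiber point the slice of [h \o piF] is constant, and derivations kill constants; if
    the smoothness test fails, the value is 0 by definition. *)
Lemma lift_base_comp_fiber X (r : P) h : lift_base F X r (h \o piF) = 0.
Proof.
rewrite /lift_base /incl_base; case: ifP => // _.
exact: tangent_cst (h r.2) (vf_tangent X r.1).
Qed.

Lemma lift_fiber_comp_base V (r : P) h : lift_fiber B V r (h \o piB) = 0.
Proof.
rewrite /lift_fiber /incl_fiber; case: ifP => // _.
exact: tangent_cst (h r.1) (vf_tangent V r.2).
Qed.

(** A constant is a pullback from the other factor. This is used when a lift differentiates a
    vanishing inner product. *)
Lemma lift_base_cst X (r : P) (a : R) : lift_base F X r (fun=> a) = 0.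
Proof. exact: (lift_base_comp_fiber X r (fun=> a)). Qed.

Lemma lift_fiber_cst V (r : P) (a : R) : lift_fiber B V r (fun=> a) = 0.
Proof. exact: (lift_fiber_comp_base V r (fun=> a)). Qed.

Lemma differential_base_lift_base X (r : P) :
  differential piB (lift_base F X r) = vf_section X r.1.
Proof. by apply/funext => h; exact: lift_base_comp_base. Qed.

Lemma differential_fiber_lift_base X (r : P) :
  differential piF (lift_base F X r) = fun=> 0.
Proof. by apply/funext => h; exact: lift_base_comp_fiber. Qed.

Lemma differential_fiber_lift_fiber V (r : P) :
  differential piF (lift_fiber B V r) = vf_section V r.2.
Proof. by apply/funext => h; exact: lift_fiber_comp_fiber. Qed.

Lemma differential_base_lift_fiber V (r : P) :
  differential piB (lift_fiber B V r) = fun=> 0.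
Proof. by apply/funext => h; exact: lift_fiber_comp_base. Qed.

Definition differential_lift := (differential_base_lift_base,
  differential_fiber_lift_base, differential_fiber_lift_fiber,
  differential_base_lift_fiber).

Lemma along_lift_base_base X h : along (lift_base F X) (h \o piB) =
  along X h \o piB.
Proof. by apply/funext => r; exact: lift_base_comp_base. Qed.

Lemma along_lift_base_fiber X h : along (lift_base F X) (h \o piF) = fun=> 0.
Proof. by apply/funext => r; exact: lift_base_comp_fiber. Qed.

Lemma along_lift_fiber_fiber V h : along (lift_fiber B V) (h \o piF) =
  along V h \o piF.
Proof. by apply/funext => r; exact: lift_fiber_comp_fiber. Qed.

Lemma along_lift_fiber_base V h : along (lift_fiber B V) (h \o piB) = fun=> 0.
Proof. by apply/funext => r; exact: lift_fiber_comp_base. Qed.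

Definition along_lift := (along_lift_base_base, along_lift_base_fiber,
  along_lift_fiber_fiber, along_lift_fiber_base).

Definition lift_comp := (lift_base_comp_base, lift_base_comp_fiber,
  lift_fiber_comp_base, lift_fiber_comp_fiber, lift_base_cst, lift_fiber_cst).

(** The projected bracket is tested on pullbacks only, and a lift turns a pullback from a factor
    into a pullback from that factor or into 0, so both iterated derivatives are explicit. *)
Lemma differential_base_bracket_base X Y (r : P) :
  differential piB (bracket (lift_base F X) (lift_base F Y) r) =
  bracket X Y r.1.
Proof.
by apply/funext => h; rewrite /differential /bracket !along_lift !lift_comp.
Qed.

Lemma differential_fiber_bracket_base X Y (r : P) :
  differential piF (bracket (lift_base F X) (lift_base F Y) r) = fun=> 0.
Proof.
apply/funext => h.
by rewrite /differential /bracket !along_lift !lift_comp subrr.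
Qed.

Lemma differential_fiber_bracket_fiber V W (r : P) :
  differential piF (bracket (lift_fiber B V) (lift_fiber B W) r) =
  bracket V W r.2.
Proof.
by apply/funext => h; rewrite /differential /bracket !along_lift !lift_comp.
Qed.

Lemma differential_base_bracket_fiber V W (r : P) :
  differential piB (bracket (lift_fiber B V) (lift_fiber B W) r) = fun=> 0.
Proof.
apply/funext => h.
by rewrite /differential /bracket !along_lift !lift_comp subrr.
Qed.

(** On [h \o piB] the lift of [V] gives 0 at once, while the lift of [X] gives a function on the
    base, which the lift of [V] kills. *)
Lemma differential_base_bracket_base_fiber X V (r : P) :
  differential piB (bracket (lift_base F X) (lift_fiber B V) r) = fun=> 0.
Proof.
apply/funext => h.
by rewrite /differential /bracket !along_lift !lift_comp subrr.
Qed.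

Lemma differential_fiber_bracket_base_fiber X V (r : P) :
  differential piF (bracket (lift_base F X) (lift_fiber B V) r) = fun=> 0.
Proof.
apply/funext => h.
by rewrite /differential /bracket !along_lift !lift_comp subrr.
Qed.

Lemma differential_base_bracket_fiber_base X V (r : P) :
  differential piB (bracket (lift_fiber B V) (lift_base F X) r) = fun=> 0.
Proof.
apply/funext => h.
by rewrite /differential /bracket !along_lift !lift_comp subrr.
Qed.

Lemma differential_fiber_bracket_fiber_base X V (r : P) :
  differential piF (bracket (lift_fiber B V) (lift_base F X) r) = fun=> 0.
Proof.
apply/funext => h.
by rewrite /differential /bracket !along_lift !lift_comp subrr.
Qed.

Definition differential_bracket := (differential_base_bracket_base,
  differential_fiber_bracket_base, differential_fiber_bracket_fiber,
  differential_base_bracket_fiber, differential_base_bracket_base_fiber,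
  differential_fiber_bracket_base_fiber, differential_base_bracket_fiber_base,
  differential_fiber_bracket_fiber_base).

(** The lift of [X] has zero [TF] component, and [J2] maps 0 to 0 by linearity. *)
Lemma act_lift_base (gF : bilinear_field F) (J1 : endo_field B)
    (J2 : endo_field F) X : almost_product_structure gF J2 ->
  act (prod_struct J1 J2) (lift_base F X) = lift_base F (act J1 X).
Proof.
move=> JP; apply/funext => r; apply/funext => h.
rewrite /act /prod_struct !differential_lift (aps0 _ JP).
(* The inclusion of the zero vector is 0 in both branches of the smoothness test. *)
by rewrite /incl_fiber if_same addr0.
Qed.

Lemma act_lift_fiber (gB : bilinear_field B) (J1 : endo_field B)
    (J2 : endo_field F) V : almost_product_structure gB J1 ->
  act (prod_struct J1 J2) (lift_fiber B V) = lift_fiber B (act J2 V).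
Proof.
move=> JP; apply/funext => r; apply/funext => h.
rewrite /act /prod_struct !differential_lift (aps0 _ JP).
by rewrite /incl_base if_same add0r.
Qed.

End lifts.

(** * Inner products and Koszul form of lifts for the warped metric *)

Section warped_metric.
Variables (R : realType) (B F : smooth_manifold R).
Variables (gB : bilinear_field B) (gF : bilinear_field F) (f : B -> R).
Hypotheses (gBP : singular_metric gB) (gFP : singular_metric gF).
Hypothesis sf : smooth f.
Implicit Types (X Y Z : vector_field B) (U V W : vector_field F).
Local Notation g := (warped_metric gB gF f).
Local Notation piB := (@proj_base _ B F).
Local Notation lB := (lift_base F).
Local Notation lF := (lift_fiber B).

Lemma inner_warped_base X Y : inner g (lB X) (lB Y) = inner gB X Y \o piB.
Proof.
apply/funext => r; rewrite /inner /warped_metric !differential_lift.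
by rewrite (metric0l gFP) ?mulr0 ?addr0//; exact: tangent0.
Qed.

Lemma inner_warped_fiber V W : inner g (lF V) (lF W) =
  fun r => f r.1 ^+ 2 * inner gF V W r.2.
Proof.
apply/funext => r; rewrite /inner /warped_metric !differential_lift.
by rewrite (metric0l gBP) ?add0r//; exact: tangent0.
Qed.

Lemma inner_warped_base_fiber X V : inner g (lB X) (lF V) = fun=> 0.
Proof.
apply/funext => r; rewrite /inner /warped_metric !differential_lift.
by rewrite (metric0r gBP (vf_tangent _ _)) (metric0l gFP (vf_tangent _ _))
  mulr0 addr0.
Qed.

Lemma inner_warped_fiber_base X V : inner g (lF V) (lB X) = fun=> 0.
Proof.
apply/funext => r; rewrite /inner /warped_metric !differential_lift.
by rewrite (metric0l gBP (vf_tangent _ _)) (metric0r gFP (vf_tangent _ _))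
  mulr0 addr0.
Qed.

Definition inner_warped := (inner_warped_base, inner_warped_fiber,
  inner_warped_base_fiber, inner_warped_fiber_base).

(** Lifts send nonsmooth functions to 0, so smoothness has to be known before this inner product can
    be differentiated slice by slice. *)
Lemma smooth_inner_warped_fiber V W :
  smooth (fun r : prod_manifold B F => f r.1 ^+ 2 * inner gF V W r.2).
Proof.
apply: smoothM; last exact: smooth_comp_fiber (metric_smooth gFP V W).
exact: smooth_comp_base (smoothM sf sf).
Qed.

(** This is the source of all warping terms: on a base slice [inner gF V W] is a constant factor,
    and [X (f^2) = 2 f X(f)]. *)
Lemma lift_base_inner_fiber X V W (r : prod_manifold B F) :
  lB X r (fun s => f s.1 ^+ 2 * inner gF V W s.2) =
  2 * (f r.1 * inner gF V W r.2 * along X f r.1).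
Proof.
rewrite lift_base_smooth /=; last exact: smooth_inner_warped_fiber.
under eq_fun do rewrite mulrC expr2.
rewrite (tangentZ _ (vf_tangent X _) (smoothM sf sf)).
rewrite (tangentM (vf_tangent X _) sf sf) /along.
by ring.
Qed.

(** On a fiber slice the factor [f^2] is constant. *)
Lemma lift_fiber_inner_fiber U V W (r : prod_manifold B F) :
  lF U r (fun s => f s.1 ^+ 2 * inner gF V W s.2) =
  f r.1 ^+ 2 * vf_section U r.2 (inner gF V W).
Proof.
rewrite lift_fiber_smooth /=; last exact: smooth_inner_warped_fiber.
by rewrite (tangentZ _ (vf_tangent U _))//; exact: metric_smooth.
Qed.

#[local] Hint Resolve tangent0 vf_tangent tangent_bracket : core.

(** These rules erase every term with a zero projection; their tangency side conditions fall to the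
    hints above. *)
Let g0 := (metric0l gBP, metric0l gFP, metric0r gBP, metric0r gFP,
  mulr0, addr0, add0r, subr0, oppr0).

Lemma koszul_base X Y Z r :
  koszul g (lB X) (lB Y) (lB Z) r = koszul gB X Y Z r.1.
Proof.
rewrite /koszul !inner_warped !lift_comp /inner /warped_metric.
by rewrite !differential_lift !differential_bracket !g0//.
Qed.

(** Lifts from different factors are orthogonal, mixed brackets project to 0, and the lift of [W]
    kills [inner gB X Y \o piB]. The next two permutations vanish likewise. *)
Lemma koszul_base_base_fiber X Y W r : koszul g (lB X) (lB Y) (lF W) r = 0.
Proof.
rewrite /koszul !inner_warped !lift_comp /inner /warped_metric.
by rewrite !differential_lift !differential_bracket !g0//.
Qed.

Lemma koszul_base_fiber_base X Y W r : koszul g (lB X) (lF W) (lB Y) r = 0.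
Proof.
rewrite /koszul !inner_warped !lift_comp /inner /warped_metric.
by rewrite !differential_lift !differential_bracket !g0//.
Qed.

Lemma koszul_fiber_base_base X Y W r : koszul g (lF W) (lB X) (lB Y) r = 0.
Proof.
rewrite /koszul !inner_warped !lift_comp /inner /warped_metric.
by rewrite !differential_lift !differential_bracket !g0//.
Qed.

(** Only the derivative of [inner gF V W] along [X] survives; its factor 2 cancels the one half of
    the Koszul form. *)
Lemma koszul_base_fiber_fiber X V W r : koszul g (lB X) (lF V) (lF W) r =
  f r.1 * inner gF V W r.2 * along X f r.1.
Proof.
rewrite /koszul !inner_warped !lift_comp lift_base_inner_fiber.
rewrite /inner /warped_metric !differential_lift !differential_bracket !g0//.
by field.
Qed.

Lemma koszul_fiber_base_fiber X V W r : koszul g (lF V) (lB X) (lF W) r =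
  f r.1 * inner gF W V r.2 * along X f r.1.
Proof.
rewrite /koszul !inner_warped !lift_comp lift_base_inner_fiber.
rewrite /inner /warped_metric !differential_lift !differential_bracket !g0//.
by field.
Qed.

(** Here [X] stands in the third slot, whose derivative enters the Koszul form with a minus sign. *)
Lemma koszul_fiber_fiber_base X V W r : koszul g (lF V) (lF W) (lB X) r =
  - (f r.1 * inner gF V W r.2 * along X f r.1).
Proof.
rewrite /koszul !inner_warped !lift_comp lift_base_inner_fiber.
rewrite /inner /warped_metric !differential_lift !differential_bracket !g0//.
by field.
Qed.

(** Derivatives and bracket terms alike carry the factor [f^2]. *)
Lemma koszul_fiber U V W r : koszul g (lF U) (lF V) (lF W) r =
  f r.1 ^+ 2 * koszul gF U V W r.2.
Proof.
rewrite /koszul !inner_warped !lift_fiber_inner_fiber.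
rewrite /inner /warped_metric !differential_lift !differential_bracket !g0//.
by ring.
Qed.

End warped_metric.

(** * The almost product Koszul form of lifts *)

Theorem proposition4p14 (R : realType) (B F : ap_manifold R) (f : B -> R)
    (hf : smooth f) (X Y Z : vector_field B) (U V W : vector_field F)
    (p : B) (q : F) :
  (* (1) *)
  warped_koszul f (lift_base F X) (lift_base F Y) (lift_base F Z) (p, q)
    = ap_koszul (ap_metric B) (ap_struct B) X Y Z p
  (* (2) *)
  /\ (warped_koszul f (lift_base F X) (lift_base F Y) (lift_fiber B W) (p, q)
        = warped_koszul f (lift_base F X) (lift_fiber B W) (lift_base F Y) (p, q)
      /\ warped_koszul f (lift_base F X) (lift_fiber B W) (lift_base F Y) (p, q)
        = warped_koszul f (lift_fiber B W) (lift_base F X) (lift_base F Y) (p, q)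
      /\ warped_koszul f (lift_fiber B W) (lift_base F X) (lift_base F Y) (p, q)
        = 0)
  (* (3) *)
  /\ warped_koszul f (lift_base F X) (lift_fiber B V) (lift_fiber B W) (p, q)
    = f p * inner (ap_metric F) V W q * along X f p
  (* (4) *)
  /\ (warped_koszul f (lift_fiber B V) (lift_base F X) (lift_fiber B W) (p, q)
        = - warped_koszul f (lift_fiber B V) (lift_fiber B W) (lift_base F X)
              (p, q)
      /\ - warped_koszul f (lift_fiber B V) (lift_fiber B W) (lift_base F X)
             (p, q)
        = 2^-1 * (f p * inner (ap_metric F) V W q * along X f p
                  + f p * along (act (ap_struct B) X) f p
                    * inner (ap_metric F) V (act (ap_struct F) W) q))
  (* (5) *)
  /\ warped_koszul f (lift_fiber B U) (lift_fiber B V) (lift_fiber B W) (p, q)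
    = f p ^+ 2 * ap_koszul (ap_metric F) (ap_struct F) U V W q.
Proof.
have [gB gF] := (ap_metricP B, ap_metricP F).
have [JB JF] := (ap_structP B, ap_structP F).
(* The image of a lift under [J] is again the lift of a vector field, so both halves of the almost
   product Koszul form are Koszul forms of lifts. *)
have actB (T : vector_field B) :
    act (prod_struct (ap_struct B) (ap_struct F)) (lift_base F T) =
    lift_base F (act_vector_field JB T) := act_lift_base _ T JF.
have actF (T : vector_field F) :
    act (prod_struct (ap_struct B) (ap_struct F)) (lift_fiber B T) =
    lift_fiber B (act_vector_field JF T) := act_lift_fiber _ T JB.
have innerC (S T : vector_field F) :
    inner (ap_metric F) S T q = inner (ap_metric F) T S q.
  by rewrite /inner (metric_symmetric gF) //; exact: vf_tangent.
(* For (3): by isometry the two halves coincide, so their average is the plain Koszul form. *)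
have innerJ : inner (ap_metric F) (act_vector_field JF V)
    (act_vector_field JF W) q = inner (ap_metric F) V W q.
  by rewrite /inner (aps_isometry JF) //; exact: vf_tangent.
rewrite /warped_koszul /ap_koszul !actB !actF.
rewrite !koszul_base // !koszul_base_base_fiber // !koszul_base_fiber_base //.
rewrite !koszul_fiber_base_base // !koszul_base_fiber_fiber //.
rewrite !koszul_fiber_base_fiber // !koszul_fiber_fiber_base //.
rewrite !koszul_fiber //= innerJ.
(* For (4): with [X] in the middle slot the Koszul form yields the arguments of [g_F] in reversed
   order, both for [W] and for [JW]. *)
rewrite (innerC W V) (innerC (act_vector_field JF W) V).
rewrite addr0 mulr0; do !split=> //; by field.
Qed.
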